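(* For a variety $\mathcal{V}$ of universal algebras the following are equivalent. \begin{enumerate} \item For any object $X$ in $\mathcal{V}$, the product of two coequalizer diagrams in $\mathrm{Pt}_{\mathcal{V}}(X)$ is a coequalizer diagram (in $\mathrm{Pt}_{\mathcal{V}}(X)$). \item For any object $X$ in $\mathcal{V}$, the product of two normal epimorphisms in $\mathrm{Pt}_{\mathcal{V}}(X)$ is a normal epimorphism. \item $\mathcal{V}$ has normal local projections. \item There exist positive integers $m,n$ such that $\mathcal{V}$ admits binary terms $b_1,\dots,b_m,c_1,\dots,c_m$ and $(m+2)$-ary terms $p_1,p_2,\dots,p_n$ such that the following identities hold: \begin{itemize} \item $p_1(x,y,b_1(x,y),\dots,b_m(x,y)) = x$; \item $p_n(y,x,b_1(x,y),\dots,b_m(x,y)) = y$; \item $p_i(y,x,b_1(x,y),\dots,b_m(x,y)) = p_{i+1}(x,y,b_1(x,y),\dots,b_m(x,y))$ for each $1\leqslant i\leqslant n-1$; \item $p_i(u,u,c_1(u,v),\dots,c_m(u,v)) = v$ for every $i\in\{1,\dots,n\}$, and $b_i(z,z)=c_i(z,z)$ for every $i\in\{1,\dots,m\}$. \end{itemize} \item For any two morphisms $f:A\to X$ and $g:B\to X$ in $\mathcal{V}$, and any congruence $C$ on the pullback $A\times_X B$ of $f$ along $g$, if $(x,u)\,C\,(y,u)$ then $(x,v)\,C\,(y,v)$, for all $(x,u),(y,u),(x,v),(y,v)\in A\times_X B$. \end{enumerate}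
   Context: A variety is regarded as a category whose morphisms are the homomorphisms. For an object $X$ of a category $\mathbb{C}$, the category of points $\mathrm{Pt}_{\mathbb{C}}(X)$ has as objects triples $(A,p,s)$ where $p:A\to X$ is a split epimorphism and $s:X\to A$ is a splitting of $p$ (i.e. $p\circ s=1_X$); a morphism $f:(A,p,s)\to(B,q,t)$ is a morphism $f:A\to B$ of $\mathbb{C}$ with $q\circ f=p$ and $f\circ s=t$. It is a pointed category with zero object $(X,1_X,1_X)$; the zero morphism $(A,p,s)\to(B,q,t)$ is $t\circ p$. When $\mathbb{C}$ has pullbacks, the product of $(A,p,s)$ and $(B,q,t)$ in $\mathrm{Pt}_{\mathbb{C}}(X)$ is given by the pullback $A\times_X B$ of $p$ and $q$ with its canonical morphism to $X$ and the splitting $(s,t)$. The product of two coequalizer diagrams $C_1\rightrightarrows Y\xrightarrow{q_1}Y'$ (parallel pair $u,v$) and $C_2\rightrightarrows Z\xrightarrow{q_2}Z'$ (parallel pair $u',v'$) is the diagram $C_1\times C_2\rightrightarrows Y\times Z\xrightarrow{q_1\times q_2}Y'\times Z'$ with parallel pair $u\times u'$, $v\times v'$. A normal epimorphism in a pointed category is a morphism that is a cokernel of some morphism. A pointed category has normal projections if every product projection in it is a normal epimorphism. A category $\mathbb{C}$ has normal local projections if for every object $X$ the category $\mathrm{Pt}_{\mathbb{C}}(X)$ has normal projections. *)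

(* Defs.v *)
From mathcomp Require Import all_boot boolp.

Set Implicit Arguments.
Unset Strict Implicit.
Unset Printing Implicit Defensive.

Declare Scope category_scope.
Delimit Scope category_scope with cat.
Local Open Scope category_scope.
Local Obligation Tactic := idtac.

(** * Categories *)

Record category := Category {
  obj :> Type;
  hom : obj -> obj -> Type;
  idm : forall A, hom A A;
  compm : forall A B C, hom B C -> hom A B -> hom A C;
  compmA : forall A B C D (h : hom C D) (g : hom B C) (f : hom A B),
    compm h (compm g f) = compm (compm h g) f;
  comp1m : forall A B (f : hom A B), compm (idm B) f = f;
  compm1 : forall A B (f : hom A B), compm f (idm A) = f
}.

Arguments hom {c} A B.
Arguments idm {c} A.
Arguments compm {c A B C} g f.

Notation "g ∘ f" := (compm g f) (at level 40, left associativity)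
  : category_scope.

Definition coequalizer (C : category) (K Y Q : C) (u v : hom K Y)
    (q : hom Y Q) : Prop :=
  q ∘ u = q ∘ v /\
  forall (Z : C) (h : hom Y Z), h ∘ u = h ∘ v -> exists! k : hom Q Z, k ∘ q = h.

Record product (C : category) (A B : C) := Product {
  prod_obj :> C;
  prod_fst : hom prod_obj A;
  prod_snd : hom prod_obj B;
  prod_pair : forall Z : C, hom Z A -> hom Z B -> hom Z prod_obj;
  prod_fst_pair : forall (Z : C) (f : hom Z A) (g : hom Z B),
    prod_fst ∘ prod_pair f g = f;
  prod_snd_pair : forall (Z : C) (f : hom Z A) (g : hom Z B),
    prod_snd ∘ prod_pair f g = g;
  prod_pair_uniq : forall (Z : C) (f : hom Z A) (g : hom Z B)
    (h : hom Z prod_obj),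
    prod_fst ∘ h = f -> prod_snd ∘ h = g -> h = prod_pair f g
}.

Definition prod_mor (C : category) (A B A' B' : C) (P : product A B)
    (P' : product A' B') (f : hom A A') (g : hom B B') : hom P P' :=
  prod_pair P' (f ∘ prod_fst P) (g ∘ prod_snd P).

(* Products being unique up to isomorphism, quantifying over all choices of   *)
(* product objects is the same as fixing one; they exist in the categories of *)
(* points of a variety by [points_product] below.                             *)
Definition products_preserve_coequalizers (C : category) : Prop :=
  forall (K1 Y Y' K2 Z Z' : C)
    (u v : hom K1 Y) (q1 : hom Y Y') (u' v' : hom K2 Z) (q2 : hom Z Z')
    (PK : product K1 K2) (PY : product Y Z) (PY' : product Y' Z'),
  coequalizer u v q1 -> coequalizer u' v' q2 ->
  coequalizer (prod_mor PK PY u u') (prod_mor PK PY v v')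
    (prod_mor PY PY' q1 q2).

(** * Pointed categories *)

Record pointed_category := PointedCategory {
  pcat :> category;
  zero_obj : pcat;
  to_zero : forall A : pcat, hom A zero_obj;
  from_zero : forall A : pcat, hom zero_obj A;
  to_zeroP : forall (A : pcat) (f : hom A zero_obj), f = to_zero A;
  from_zeroP : forall (A : pcat) (f : hom zero_obj A), f = from_zero A
}.

Definition zero_mor (C : pointed_category) (A B : C) : hom A B :=
  from_zero B ∘ to_zero A.

Definition cokernel (C : pointed_category) (K A B : C) (k : hom K A)
    (f : hom A B) : Prop :=
  f ∘ k = zero_mor K B /\
  forall (Z : C) (h : hom A Z), h ∘ k = zero_mor K Z ->
    exists! h' : hom B Z, h' ∘ f = h.

Definition normal_epi (C : pointed_category) (A B : C) (f : hom A B) : Prop :=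
  exists (K : C) (k : hom K A), cokernel k f.

Definition products_preserve_normal_epis (C : pointed_category) : Prop :=
  forall (A A' B B' : C) (f : hom A A') (g : hom B B')
    (P : product A B) (P' : product A' B'),
  normal_epi f -> normal_epi g -> normal_epi (prod_mor P P' f g).

Definition normal_projections (C : pointed_category) : Prop :=
  forall (A B : C) (P : product A B),
  normal_epi (prod_fst P) /\ normal_epi (prod_snd P).

(** * Categories of points *)

Section Points.
Variables (C : category) (X : C).

Record point := Point {
  pt_obj : C;
  pt_proj : hom pt_obj X;
  pt_sec : hom X pt_obj;
  pt_split : pt_proj ∘ pt_sec = idm X
}.

Record point_hom (A B : point) := PointHom {
  pt_mor :> hom (pt_obj A) (pt_obj B);
  pt_mor_proj : pt_proj B ∘ pt_mor = pt_proj A;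
  pt_mor_sec : pt_mor ∘ pt_sec A = pt_sec B
}.

Lemma point_hom_eq (A B : point) (f g : point_hom A B) :
  pt_mor f = pt_mor g -> f = g.
Proof.
case: f g => [f f1 f2] [g g1 g2] /= E; subst g.
by congr PointHom; apply: Prop_irrelevance.
Qed.

Definition point_id (A : point) : point_hom A A :=
  PointHom (compm1 (pt_proj A)) (comp1m (pt_sec A)).

Program Definition point_comp (A B D : point) (g : point_hom B D)
    (f : point_hom A B) : point_hom A D :=
  @PointHom A D (pt_mor g ∘ pt_mor f) _ _.
Next Obligation. by move=> A B D g f; rewrite compmA !pt_mor_proj. Qed.
Next Obligation. by move=> A B D g f; rewrite -compmA !pt_mor_sec. Qed.

Program Definition points_category : category :=
  @Category point point_hom point_id point_comp _ _ _.
Next Obligation. by move=> *; apply: point_hom_eq; apply: compmA. Qed.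
Next Obligation. by move=> *; apply: point_hom_eq; apply: comp1m. Qed.
Next Obligation. by move=> *; apply: point_hom_eq; apply: compm1. Qed.

Definition point_zero : point := Point (comp1m (idm X)).

Definition point_to_zero (A : point) : point_hom A point_zero :=
  @PointHom A point_zero (pt_proj A) (comp1m _) (pt_split A).

Definition point_from_zero (A : point) : point_hom point_zero A :=
  @PointHom point_zero A (pt_sec A) (pt_split A) (compm1 _).

(* The zero morphism from (A, p, s) to (B, q, t) is, definitionally, t ∘ p.   *)
Program Definition points : pointed_category :=
  @PointedCategory points_category point_zero
    point_to_zero point_from_zero _ _.
Next Obligation.
by move=> A f; apply: point_hom_eq; rewrite /= -(pt_mor_proj f) /= comp1m.
Qed.
Next Obligation.
by move=> A f; apply: point_hom_eq; rewrite /= -(pt_mor_sec f) /= compm1.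
Qed.

End Points.

Definition normal_local_projections (C : category) : Prop :=
  forall X : C, normal_projections (points X).

(** * Universal algebra *)

Record signature := Signature { op_sym :> Type; arity : op_sym -> nat }.

Inductive term (S : signature) (V : Type) : Type :=
| Var of V
| App (o : S) of 'I_(arity o) -> term S V.

Record algebra (S : signature) := Algebra {
  carrier :> Type;
  operation : forall o : S, ('I_(arity o) -> carrier) -> carrier
}.

Fixpoint eval (S : signature) (A : algebra S) (V : Type) (env : V -> A)
    (t : term S V) : A :=
  match t with
  | Var x => env x
  | App o ts => operation (fun i => eval env (ts i))
  end.

(* The values of a binary term at (x, y) and of an (m + 2)-ary term at        *)
(* (x, y, z_1, ..., z_m).                                                     *)
Definition eval2 (S : signature) (A : algebra S) (t : term S 'I_2)
    (x y : A) : A :=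
  eval (tnth [tuple x; y]) t.

Definition eval_xyz (S : signature) (A : algebra S) (m : nat)
    (t : term S 'I_m.+2) (x y : A) (z : 'I_m -> A) : A :=
  eval (tnth [tuple of x :: y :: [tuple z i | i < m]]) t.

(* A set of identities; [E s t] stands for the identity s = t.                *)
Definition identities (S : signature) := term S nat -> term S nat -> Prop.

(* The members of the variety defined by E. The empty algebra is a member     *)
(* when the signature has no constant symbol.                                 *)
Record model (S : signature) (E : identities S) := Model {
  model_alg :> algebra S;
  model_sat : forall s t, E s t ->
    forall env : nat -> model_alg, eval env s = eval env t
}.

Record homomorphism (S : signature) (A B : algebra S) := Homomorphism {
  hom_fun :> A -> B;
  hom_op : forall (o : S) (a : 'I_(arity o) -> A),
    hom_fun (operation a) = operation (fun i => hom_fun (a i))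
}.

Lemma homomorphism_eq (S : signature) (A B : algebra S)
  (f g : homomorphism A B) : f =1 g -> f = g.
Proof.
case: f g => [f f1] [g g1] /= /funext E; subst g.
by congr Homomorphism; apply: Prop_irrelevance.
Qed.

Lemma hom_eval (S : signature) (A B : algebra S) (f : homomorphism A B)
    (V : Type) (env : V -> A) (t : term S V) :
  f (eval env t) = eval (fun v => f (env v)) t.
Proof.
elim: t => [v|o ts IH] //=; rewrite hom_op.
by congr operation; apply: funext => i; apply: IH.
Qed.

Definition hom_id (S : signature) (A : algebra S) : homomorphism A A :=
  @Homomorphism S A A id (fun _ _ => erefl).

Program Definition hom_comp (S : signature) (A B C : algebra S)
    (g : homomorphism B C) (f : homomorphism A B) : homomorphism A C :=
  @Homomorphism S A C (fun x => g (f x)) _.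
Next Obligation. by move=> S A B C g f o a /=; rewrite !hom_op. Qed.

Program Definition variety (S : signature) (E : identities S) : category :=
  @Category (model E) (@homomorphism S) (@hom_id S) (@hom_comp S) _ _ _.
Next Obligation. by move=> *; apply: homomorphism_eq. Qed.
Next Obligation. by move=> *; apply: homomorphism_eq. Qed.
Next Obligation. by move=> *; apply: homomorphism_eq. Qed.

Record congruence (S : signature) (A : algebra S) (R : A -> A -> Prop) : Prop :=
  Congruence {
    cong_refl : forall a, R a a;
    cong_sym : forall a b, R a b -> R b a;
    cong_trans : forall a b c, R a b -> R b c -> R a c;
    cong_op : forall (o : S) (a b : 'I_(arity o) -> A),
      (forall i, R (a i) (b i)) -> R (operation a) (operation b)
  }.

Section Pullback.
Variables (S : signature) (A B X : algebra S).
Variables (f : homomorphism A X) (g : homomorphism B X).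

Definition pullback_carrier := {ab : A * B | f ab.1 = g ab.2}.

Lemma pullback_eq (a b : pullback_carrier) : sval a = sval b -> a = b.
Proof.
by case: a b => [a p] [b q] /= E; subst b; congr exist; apply: Prop_irrelevance.
Qed.

Program Definition pullback_op (o : S) (a : 'I_(arity o) -> pullback_carrier) :
    pullback_carrier :=
  exist _ (operation (fun i => (sval (a i)).1),
           operation (fun i => (sval (a i)).2)) _.
Next Obligation.
move=> o a /=; rewrite !hom_op.
by congr operation; apply: funext => i; exact: (svalP (a i)).
Qed.

Definition pullback : algebra S := Algebra pullback_op.

Definition pullback_elt (a : A) (b : B) (h : f a = g b) : pullback :=
  exist _ (a, b) h.

Definition pullback_fst : homomorphism pullback A :=
  @Homomorphism S pullback A (fun a => (sval a).1) (fun _ _ => erefl).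

Definition pullback_snd : homomorphism pullback B :=
  @Homomorphism S pullback B (fun a => (sval a).2) (fun _ _ => erefl).

End Pullback.

Section PointsProduct.
Variables (S : signature) (E : identities S).

Program Definition pullback_model (A B X : model E) (f : homomorphism A X)
    (g : homomorphism B X) : model E :=
  @Model S E (pullback f g) _.
Next Obligation.
move=> A B X f g s t Est env; apply: pullback_eq.
have e1 := hom_eval (pullback_fst f g) env; have e2 := hom_eval (pullback_snd f g) env.
rewrite [LHS]surjective_pairing [RHS]surjective_pairing.
by congr pair; [move: (e1 s) (e1 t)|move: (e2 s) (e2 t)] => /= -> ->; apply: model_sat.
Qed.

Section Product.
Variables (X : variety E) (A B : points X).

Let p : homomorphism (pt_obj A) X := pt_proj A.
Let q : homomorphism (pt_obj B) X := pt_proj B.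
Let s : homomorphism X (pt_obj A) := pt_sec A.
Let t : homomorphism X (pt_obj B) := pt_sec B.

Lemma points_product_sec_subproof (x : X) : p (s x) = q (t x).
Proof.
have := congr1 (fun h : homomorphism X X => h x) (pt_split A).
have := congr1 (fun h : homomorphism X X => h x) (pt_split B).
by rewrite /p /q /s /t /= => -> ->.
Qed.

Program Definition points_product_sec : homomorphism X (pullback p q) :=
  @Homomorphism S X (pullback p q)
    (fun x => pullback_elt (points_product_sec_subproof x)) _.
Next Obligation. by move=> o a; apply: pullback_eq; rewrite /= !hom_op. Qed.

Program Definition points_product_obj : points X :=
  @Point (variety E) X (pullback_model p q) (hom_comp p (pullback_fst p q))
    points_product_sec _.
Next Obligation.
apply: homomorphism_eq => x /=.
exact: (congr1 (fun h : homomorphism X X => h x) (pt_split A)).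
Qed.

Program Definition points_product_fst : hom points_product_obj A :=
  @PointHom (variety E) X points_product_obj A (pullback_fst p q) _ _.
Next Obligation. exact: homomorphism_eq. Qed.
Next Obligation. exact: homomorphism_eq. Qed.

Program Definition points_product_snd : hom points_product_obj B :=
  @PointHom (variety E) X points_product_obj B (pullback_snd p q) _ _.
Next Obligation. by apply: homomorphism_eq => -[[a b] /= h]. Qed.
Next Obligation. exact: homomorphism_eq. Qed.

Section Pair.
Variables (Z : points X) (f : hom Z A) (g : hom Z B).

Let f' : homomorphism (pt_obj Z) (pt_obj A) := pt_mor f.
Let g' : homomorphism (pt_obj Z) (pt_obj B) := pt_mor g.

Lemma points_product_pair_subproof (z : model_alg (pt_obj Z)) :
  p (f' z) = q (g' z).
Proof.
have := congr1 (fun h : homomorphism (pt_obj Z) X => h z) (pt_mor_proj f).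
have := congr1 (fun h : homomorphism (pt_obj Z) X => h z) (pt_mor_proj g).
by rewrite /p /q /f' /g' /= => -> ->.
Qed.

Program Definition points_product_pair_hom :
    homomorphism (pt_obj Z) (pullback p q) :=
  @Homomorphism S (pt_obj Z) (pullback p q)
    (fun z => pullback_elt (points_product_pair_subproof z)) _.
Next Obligation. by move=> o a; apply: pullback_eq; rewrite /= !hom_op. Qed.

Program Definition points_product_pair : hom Z points_product_obj :=
  @PointHom (variety E) X Z points_product_obj points_product_pair_hom _ _.
Next Obligation.
apply: homomorphism_eq => z /=.
exact: (congr1 (fun h : homomorphism (pt_obj Z) X => h z) (pt_mor_proj f)).
Qed.
Next Obligation.
apply: homomorphism_eq => x; apply: pullback_eq => /=; congr pair.
  exact: (congr1 (fun h : homomorphism X (pt_obj A) => h x) (pt_mor_sec f)).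
exact: (congr1 (fun h : homomorphism X (pt_obj B) => h x) (pt_mor_sec g)).
Qed.

End Pair.

Program Definition points_product : product A B :=
  @Product (points X) A B points_product_obj points_product_fst
    points_product_snd points_product_pair _ _ _.
Next Obligation. by move=> Z f g; apply: point_hom_eq; apply: homomorphism_eq. Qed.
Next Obligation. by move=> Z f g; apply: point_hom_eq; apply: homomorphism_eq. Qed.
Next Obligation.
move=> Z f g h <- <-; apply: point_hom_eq; apply: homomorphism_eq => z.
by apply: pullback_eq; apply: surjective_pairing.
Qed.

End Product.
End PointsProduct.

(* Main.v *)
Require Import Defs.
From mathcomp Require Import all_boot.
From mathcomp Require Import boolp.

(* The link between the categorical and the algebraic conditions is that, when
   the second projection of A x_X B is a cokernel in the points over X, its
   kernel congruence is the least one containing all pairs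
   ((a, t f a), (s f a, t f a)). Take A and B free on two generators, folded
   onto the free algebra X on one generator, with the sections picking the
   first generator x of A and u of B. Each such pair is then obtained by
   applying a binary term to ((x, u), (y, u)) and the reflexive pair
   ((x, u), (x, u)), so the congruence generated by ((x, u), (y, u)) contains
   ((x, v), (y, v)), and Mal'tsev's description of principal congruences yields
   the terms p_i, with the remaining arguments (b_j(x, y), c_j(u, v)) in the
   pullback. Conversely, the transfer of congruences from the section of B to
   all elements of a fibre shows that a morphism h out of a product which
   coequalizes u x u' and v x v' identifies (y, z) and (y', z) as soon as
   q1 y = q1 y', and symmetrically in z; as q1 x q2 is surjective, h factors
   through it. *)

Set Implicit Arguments.
Unset Strict Implicit.
Unset Printing Implicit Defensive.

Local Open Scope category_scope.

(** * Pointed categories *)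

Lemma fst_prod_mor (C : category) (A B A' B' : C) (P : product A B)
    (P' : product A' B') (f : hom A A') (g : hom B B') :
  prod_fst P' ∘ prod_mor P P' f g = f ∘ prod_fst P.
Proof. exact: prod_fst_pair. Qed.

Lemma snd_prod_mor (C : category) (A B A' B' : C) (P : product A B)
    (P' : product A' B') (f : hom A A') (g : hom B B') :
  prod_snd P' ∘ prod_mor P P' f g = g ∘ prod_snd P.
Proof. exact: prod_snd_pair. Qed.

Lemma product_hom_ext (C : category) (A B Z : C) (P : product A B)
    (h k : hom Z P) :
  prod_fst P ∘ h = prod_fst P ∘ k -> prod_snd P ∘ h = prod_snd P ∘ k -> h = k.
Proof.
by move=> e1 e2; rewrite (prod_pair_uniq e1 e2); apply/esym/prod_pair_uniq.
Qed.

Definition product_swap (C : category) (A B : C) (P : product A B) :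
    product B A :=
  @Product C B A P (prod_snd P) (prod_fst P) (fun Z f g => prod_pair P g f)
    (fun Z f g => prod_snd_pair P g f) (fun Z f g => prod_fst_pair P g f)
    (fun Z f g h hf hg => prod_pair_uniq hg hf).

Lemma zero_mor_compr (C : pointed_category) (A B D : C) (h : hom B D) :
  h ∘ zero_mor A B = zero_mor A D.
Proof. by rewrite /zero_mor compmA (from_zeroP (h ∘ _)). Qed.

Lemma zero_mor_compl (C : pointed_category) (A B D : C) (h : hom A B) :
  zero_mor B D ∘ h = zero_mor A D.
Proof. by rewrite /zero_mor -compmA (to_zeroP (_ ∘ h)). Qed.

Lemma prod_mor_zero (C : pointed_category) (A B A' B' : C)
    (P : product A B) (P' : product A' B') :
  prod_mor P P' (zero_mor A A') (zero_mor B B') = zero_mor P P'.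
Proof.
by apply: product_hom_ext;
   rewrite ?(fst_prod_mor, snd_prod_mor) zero_mor_compl zero_mor_compr.
Qed.

Lemma prod_mor_inl (C : pointed_category) (A B A' B' : C)
    (P : product A B) (P' : product A' B') (f : hom A A') (g : hom B B') :
  prod_pair P' (idm A') (zero_mor A' B') ∘ f
  = prod_mor P P' f g ∘ prod_pair P (idm A) (zero_mor A B).
Proof.
apply: product_hom_ext; rewrite !compmA.
  by rewrite fst_prod_mor prod_fst_pair -compmA prod_fst_pair comp1m compm1.
rewrite snd_prod_mor prod_snd_pair -compmA prod_snd_pair.
by rewrite zero_mor_compl zero_mor_compr.
Qed.

Lemma cokernelE (C : pointed_category) (K A B : C) (k : hom K A) (f : hom A B) :
  cokernel k f <-> coequalizer k (zero_mor K A) f.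
Proof.
rewrite /cokernel /coequalizer zero_mor_compr.
by split=> -[-> U]; split=> // Z h; have := U Z h; rewrite zero_mor_compr.
Qed.

Lemma normal_epi_id (C : pointed_category) (A : C) : normal_epi (idm A).
Proof.
exists (zero_obj C), (from_zero A); split=> [|Z h _].
  by rewrite comp1m; apply/esym/from_zeroP.
by exists h; split=> [|k]; rewrite compm1.
Qed.

Lemma normal_epi_to_zero (C : pointed_category) (A : C) : normal_epi (to_zero A).
Proof.
exists A, (idm A); split=> [|Z h]; rewrite compm1.
  by apply/esym/to_zeroP.
move=> ->; exists (from_zero Z); split=> // k _.
by apply/esym/from_zeroP.
Qed.

Lemma id_to_zero_pair_uniq (C : pointed_category) (A Z : C) (f : hom Z A)
    (g : hom Z (zero_obj C)) (h : hom Z A) :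
  idm A ∘ h = f -> to_zero A ∘ h = g -> h = f.
Proof. by rewrite comp1m. Qed.

Lemma to_zero_comp (C : pointed_category) (A Z : C) (f : hom Z A)
    (g : hom Z (zero_obj C)) : to_zero A ∘ f = g.
Proof. by rewrite (to_zeroP g); apply: to_zeroP. Qed.

Definition product_zero_r (C : pointed_category) (A : C) :
    product A (zero_obj C) :=
  @Product C A (zero_obj C) A (idm A) (to_zero A) (fun _ f _ => f)
    (fun _ f _ => comp1m f) (fun _ f g => to_zero_comp f g)
    (@id_to_zero_pair_uniq C A).

Definition product_zero_l (C : pointed_category) (B : C) :
    product (zero_obj C) B :=
  @Product C (zero_obj C) B B (to_zero B) (idm B) (fun _ _ g => g)
    (fun _ f g => to_zero_comp g f) (fun _ _ g => comp1m g)
    (fun _ _ _ _ hf hg => id_to_zero_pair_uniq hg hf).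

(* The projections of A * B are id * 0 and 0 * id, where A * 0 = A and 0 * B = B. *)
Lemma preserve_normal_epis_projections (C : pointed_category) :
  products_preserve_normal_epis C -> normal_projections C.
Proof.
move=> N A B P; split.
  have := N _ _ _ _ _ _ P (product_zero_r A) (normal_epi_id A)
            (normal_epi_to_zero B).
  by rewrite /prod_mor /= comp1m.
have := N _ _ _ _ _ _ P (product_zero_l B) (normal_epi_to_zero A)
          (normal_epi_id B).
by rewrite /prod_mor /= comp1m.
Qed.

Lemma preserve_coequalizers_normal_epis (C : pointed_category) :
  (forall A B : C, exists P : product A B, True) ->
  products_preserve_coequalizers C -> products_preserve_normal_epis C.
Proof.
move=> hasP pres A A' B B' f g P P' [K [k /cokernelE kf]] [L [l /cokernelE lg]].
have [PK _] := hasP K L.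
exists PK, (prod_mor PK P k l); apply/cokernelE.
by rewrite -(prod_mor_zero PK P); apply: pres.
Qed.

(** * Quotients and free algebras *)

Section Quotient.
Variables (S : signature) (A : algebra S) (R : A -> A -> Prop).

Definition quot_carrier := {c : A -> Prop | exists a, c = R a}.

Definition quot_class (a : A) : quot_carrier :=
  exist _ (R a) (ex_intro _ a erefl).

Definition quot_repr (c : quot_carrier) : A := projT1 (cid (svalP c)).

Definition quot_algebra : algebra S :=
  @Algebra S quot_carrier
    (fun o a => quot_class (operation (fun i => quot_repr (a i)))).

Lemma quot_reprK (c : quot_carrier) : quot_class (quot_repr c) = c.
Proof.
case: c => c hc; rewrite /quot_repr /quot_class.
case: cid => a /= E; subst c; congr exist; exact: Prop_irrelevance.
Qed.

Hypothesis Rc : congruence R.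

Lemma quot_classP (a b : A) : quot_class a = quot_class b <-> R a b.
Proof.
split=> [E|Rab].
  have /= -> := congr1 sval E; exact: cong_refl Rc b.
have E : R a = R b.
  apply: funext => c; apply: propext; split.
    exact: (cong_trans Rc (cong_sym Rc Rab)).
  exact: (cong_trans Rc Rab).
rewrite /quot_class; move: (ex_intro _ a _) (ex_intro _ b _).
by rewrite E => e1 e2; congr exist; apply: Prop_irrelevance.
Qed.

Lemma quot_class_op (o : S) (a : 'I_(arity o) -> A) :
  quot_class (operation a) =
  operation (a := quot_algebra) (fun i => quot_class (a i)).
Proof.
apply/quot_classP; apply: (cong_op Rc) => i; apply/quot_classP.
by rewrite quot_reprK.
Qed.

Definition quot_hom : homomorphism A quot_algebra :=
  @Homomorphism S A quot_algebra quot_class quot_class_op.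

Lemma quot_hom_surj (c : quot_algebra) : exists a, quot_hom a = c.
Proof. by exists (quot_repr c); apply: quot_reprK. Qed.

Lemma quot_sat (s t : term S nat) :
  (forall env : nat -> A, R (eval env s) (eval env t)) ->
  forall env : nat -> quot_algebra, eval env s = eval env t.
Proof.
move=> st env.
have -> : env = fun v => quot_hom (quot_repr (env v)).
  by apply: funext => v /=; rewrite quot_reprK.
by rewrite -!hom_eval; apply/quot_classP.
Qed.

End Quotient.

Lemma factor_surj (S : signature) (A B C : algebra S) (q : homomorphism A B)
    (h : homomorphism A C) :
  (forall b, exists a, q a = b) ->
  (forall a a', q a = q a' -> h a = h a') ->
  exists k : homomorphism B C, forall a, k (q a) = h a.
Proof.
move=> /choice[r rK] qh.
have kop (o : S) (b : 'I_(arity o) -> B) :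
    h (r (operation b)) = operation (fun i => h (r (b i))).
  rewrite -hom_op; apply: qh; rewrite rK hom_op.
  by congr operation; apply: funext => i; rewrite rK.
by exists (@Homomorphism S B C (fun b => h (r b)) kop) => a /=; apply: qh; rewrite rK.
Qed.

Lemma cong_eval (S : signature) (A : algebra S) (R : A -> A -> Prop) V
    (env env' : V -> A) (t : term S V) : congruence R ->
  (forall v, R (env v) (env' v)) -> R (eval env t) (eval env' t).
Proof. by move=> Rc Rv; elim: t => //= o ts IH; apply: cong_op. Qed.

Lemma congruence_ker (S : signature) (A B : algebra S) (f : homomorphism A B) :
  congruence (fun a b => f a = f b).
Proof.
split=> // [a b c -> //|o a b E].
by rewrite !hom_op; congr operation; apply: funext.
Qed.

Lemma eq_eval (S : signature) (A : algebra S) V (env env' : V -> A)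
    (t : term S V) : env =1 env' -> eval env t = eval env' t.
Proof. by move=> /funext ->. Qed.

Section Free.
Variables (S : signature) (E : identities S).

Definition term_algebra (V : Type) : algebra S := Algebra (@App S V).

Definition eval_hom (A : algebra S) V (env : V -> A) :
    homomorphism (term_algebra V) A :=
  @Homomorphism S (term_algebra V) A (eval env) (fun _ _ => erefl).

Lemma eval_Var V (t : term S V) : eval (A := term_algebra V) (@Var S V) t = t.
Proof. by elim: t => //= o ts IH; congr App; apply: funext. Qed.

Definition identity (V : Type) (s t : term S V) : Prop :=
  forall (A : model E) (env : V -> A), eval env s = eval env t.

Lemma congruence_identity V : congruence (A := term_algebra V) (@identity V).
Proof.
split=> // [s t st A env|r s t rs st A env|o s t st A env] /=.
- by rewrite st.
- by rewrite rs st.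
- by congr operation; apply: funext => i; apply: st.
Qed.

Lemma free_sat V s t : E s t ->
  forall env : nat -> quot_algebra (A := term_algebra V) (@identity V),
    eval env s = eval env t.
Proof.
move=> Est; apply: (quot_sat (congruence_identity V)) => env A env'.
have ev := hom_eval (eval_hom env') env.
by move: (ev s) (ev t) => /= -> ->; apply: model_sat.
Qed.

Definition free (V : Type) : model E := Model (@free_sat V).

Definition free_class V : homomorphism (term_algebra V) (free V) :=
  quot_hom (congruence_identity V).

Definition gen V (v : V) : free V := free_class V (Var S v).

Lemma free_classE V (t : term S V) : free_class V t = eval (@gen V) t.
Proof. by rewrite -[in LHS](eval_Var t) hom_eval. Qed.

Lemma free_class_surj V (a : free V) : exists t, a = free_class V t.
Proof. by have [t <-] := quot_hom_surj (congruence_identity V) a; exists t. Qed.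

Lemma free_lift V (A : model E) (env : V -> A) :
  exists k : homomorphism (free V) A,
    (forall v, k (gen v) = env v) /\ forall t, k (free_class V t) = eval env t.
Proof.
have [||k kE] := @factor_surj S _ _ _ (free_class V) (eval_hom env).
- by move=> b; have [t ->] := free_class_surj b; exists t.
- by move=> s t /(quot_classP (congruence_identity V)) st; apply: st.
by exists k; split=> [v|//]; rewrite kE.
Qed.

Lemma free_hom_ext V (A : algebra S) (f g : homomorphism (free V) A) :
  (forall v, f (gen v) = g (gen v)) -> f = g.
Proof.
move=> fg; apply: homomorphism_eq => a; have [t ->] := free_class_surj a.
by rewrite free_classE !hom_eval; apply: eq_eval.
Qed.

End Free.

Arguments free_class {S} E {V}.
Arguments gen {S} E {V} v.

(** * Points of a variety *)

Section PointElements.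
Variables (S : signature) (E : identities S) (X : variety E).

Definition pt_model (A : points X) : model E := pt_obj A.

Definition pt_fun (A B : points X) (f : hom A B) :
  homomorphism (pt_model A) (pt_model B) := pt_mor f.

Definition proj (A : points X) : homomorphism (pt_model A) (X : model E) :=
  pt_proj A.

Definition sec (A : points X) : homomorphism (X : model E) (pt_model A) :=
  pt_sec A.

Lemma pt_fun_proj (A B : points X) (f : hom A B) a :
  proj B (pt_fun f a) = proj A a.
Proof. exact: (congr1 (fun g : homomorphism _ _ => g a) (pt_mor_proj f)). Qed.

Lemma pt_fun_sec (A B : points X) (f : hom A B) x :
  pt_fun f (sec A x) = sec B x.
Proof. exact: (congr1 (fun g : homomorphism _ _ => g x) (pt_mor_sec f)). Qed.

Lemma sec_proj (A : points X) x : proj A (sec A x) = x.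
Proof. exact: (congr1 (fun g : homomorphism _ _ => g x) (pt_split A)). Qed.

Lemma pt_fun_inj (A B : points X) (f g : hom A B) :
  (forall a, pt_fun f a = pt_fun g a) -> f = g.
Proof. by move=> fg; apply: point_hom_eq; apply: homomorphism_eq. Qed.

Lemma pt_fun_eq (A B D D' : points X) (f : hom A B) (g : hom B D)
    (f' : hom A D') (g' : hom D' D) a :
  g ∘ f = g' ∘ f' -> pt_fun g (pt_fun f a) = pt_fun g' (pt_fun f' a).
Proof. exact: (congr1 (fun k : hom A D => pt_fun k a)). Qed.

Definition pt_surj (A B : points X) (q : hom A B) : Prop :=
  forall b, exists a, pt_fun q a = b.

Lemma pt_surj_epi (A B D : points X) (q : hom A B) (k l : hom B D) :
  pt_surj q -> k ∘ q = l ∘ q -> k = l.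
Proof.
move=> qs kl; apply: pt_fun_inj => b; have [a <-] := qs b.
exact: pt_fun_eq.
Qed.

Lemma pt_factor (A B D : points X) (q : hom A B) (h : hom A D) :
  pt_surj q ->
  (forall a a', pt_fun q a = pt_fun q a' -> pt_fun h a = pt_fun h a') ->
  exists k : hom B D, k ∘ q = h.
Proof.
move=> qs qh; have [k kq] := factor_surj qs qh.
have kp : compm (pt_proj D) (k : hom (pt_obj B) (pt_obj D)) = pt_proj B.
  apply: homomorphism_eq => b; have [a <-] := qs b.
  by have := kq a => /= ->; rewrite [LHS]pt_fun_proj [RHS]pt_fun_proj.
have ks : compm (k : hom (pt_obj B) (pt_obj D)) (pt_sec B) = pt_sec D.
  apply: homomorphism_eq => x /=.
  have /= <- := pt_fun_sec q x; have /= -> := kq (sec A x).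
  exact: pt_fun_sec.
by exists (@PointHom (variety E) X B D k kp ks); apply: pt_fun_inj.
Qed.

Lemma pt_quotient (A : points X) (R : pt_model A -> pt_model A -> Prop) :
  congruence R -> (forall a b, R a b -> proj A a = proj A b) ->
  exists (Q : points X) (q : hom A Q),
    pt_surj q /\ forall a b, pt_fun q a = pt_fun q b <-> R a b.
Proof.
move=> Rc Rp.
have sat s t : E s t -> forall env : nat -> quot_algebra R, eval env s = eval env t.
  move=> Est; apply: (quot_sat Rc) => env.
  by rewrite (model_sat Est); apply: cong_refl Rc _.
pose Q : model E := Model sat.
pose q : homomorphism (pt_model A) Q := quot_hom Rc.
have [|p pq] := @factor_surj S _ _ _ q (proj A) (quot_hom_surj Rc).
  by move=> a b /(quot_classP Rc); apply: Rp.
have split : compm (p : hom (Q : variety E) X) (hom_comp q (sec A)) = idm X.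
  by apply: homomorphism_eq => x /=; have /= -> := pq (sec A x); apply: sec_proj.
pose QP : points X := Point split.
have qp : compm (pt_proj QP) (q : hom (pt_obj A) (pt_obj QP)) = pt_proj A.
  exact: homomorphism_eq.
exists QP, (@PointHom (variety E) X A QP q qp erefl); split.
  exact: quot_hom_surj.
exact: quot_classP Rc.
Qed.

Lemma coequalizer_surj (K A B : points X) (u v : hom K A) (q : hom A B) :
  coequalizer u v q -> pt_surj q.
Proof.
move=> [quv U].
have [||Q [r [rs rP]]] := @pt_quotient A (fun a b => pt_fun q a = pt_fun q b).
- exact: congruence_ker.
- by move=> a b E1; rewrite -(pt_fun_proj q a) -(pt_fun_proj q b) E1.
have [|k [kq _]] := U Q r.
  by apply: pt_fun_inj => c; apply/rP; apply: pt_fun_eq.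
have [|i ir] := @pt_factor A Q B r q rs; first by move=> a b /rP.
have ik : i ∘ k = idm B.
  have [l [_ lu]] := U B q quv.
  by apply: etrans (esym (lu _ _)) (lu _ _); rewrite ?comp1m // -compmA kq.
move=> b; have [a ab] := rs (pt_fun k b).
exists a; rewrite -[b]/(pt_fun (idm B) b) -ik -ir.
exact: (congr1 (pt_fun i) ab).
Qed.

Lemma coequalizer_ker (K A B : points X) (u v : hom K A) (q : hom A B)
    (R : pt_model A -> pt_model A -> Prop) :
  coequalizer u v q -> congruence R ->
  (forall a b, R a b -> proj A a = proj A b) ->
  (forall c, R (pt_fun u c) (pt_fun v c)) ->
  forall a b, pt_fun q a = pt_fun q b -> R a b.
Proof.
move=> [_ U] Rc Rp Ruv a b qab; have [Q [r [_ rP]]] := pt_quotient Rc Rp.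
have [|k [kq _]] := U Q r; first by apply: pt_fun_inj => c; apply/rP.
apply/rP; rewrite -kq; exact: (congr1 (pt_fun k) qab).
Qed.

Lemma coequalizer_intro (K A B : points X) (u v : hom K A) (q : hom A B) :
  pt_surj q -> q ∘ u = q ∘ v ->
  (forall (D : points X) (h : hom A D), h ∘ u = h ∘ v ->
     forall a b, pt_fun q a = pt_fun q b -> pt_fun h a = pt_fun h b) ->
  coequalizer u v q.
Proof.
move=> qs quv U; split=> // D h huv.
have [k kq] := pt_factor qs (U D h huv).
by exists k; split=> // l lq; apply: (pt_surj_epi qs); rewrite kq.
Qed.

Section ProductElements.
Variables (A B : points X) (P : product A B).

Definition of_pullback :
    homomorphism (pullback (proj A) (proj B)) (pt_model P) :=
  pt_fun (prod_pair P (points_product_fst A B) (points_product_snd A B)).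

Lemma fst_of_pullback r : pt_fun (prod_fst P) (of_pullback r) = (sval r).1.
Proof.
exact: (congr1 (fun k : hom (points_product_obj A B) A => pt_fun k r)
  (prod_fst_pair P (points_product_fst A B) (points_product_snd A B))).
Qed.

Lemma snd_of_pullback r : pt_fun (prod_snd P) (of_pullback r) = (sval r).2.
Proof.
exact: (congr1 (fun k : hom (points_product_obj A B) B => pt_fun k r)
  (prod_snd_pair P (points_product_fst A B) (points_product_snd A B))).
Qed.

Lemma product_elt_ext (w w' : pt_model P) :
  pt_fun (prod_fst P) w = pt_fun (prod_fst P) w' ->
  pt_fun (prod_snd P) w = pt_fun (prod_snd P) w' -> w = w'.
Proof.
pose psi := prod_pair P (points_product_fst A B) (points_product_snd A B).
pose phi := prod_pair (points_product A B) (prod_fst P) (prod_snd P).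
have E1 : psi ∘ phi = idm (P : points X).
  apply: product_hom_ext; rewrite compmA compm1.
    rewrite prod_fst_pair.
    exact: (prod_fst_pair (points_product A B) (prod_fst P) (prod_snd P)).
  rewrite prod_snd_pair.
  exact: (prod_snd_pair (points_product A B) (prod_fst P) (prod_snd P)).
move=> e1 e2; rewrite -[w]/(pt_fun (idm (P : points X)) w).
rewrite -[w']/(pt_fun (idm (P : points X)) w') -E1; apply: (congr1 (pt_fun psi)).
by apply: pullback_eq; rewrite /= [LHS]surjective_pairing /=; congr pair.
Qed.

Lemma product_eltP (a : pt_model A) (b : pt_model B) : proj A a = proj B b ->
  exists w, pt_fun (prod_fst P) w = a /\ pt_fun (prod_snd P) w = b.
Proof.
move=> ab; exists (of_pullback (pullback_elt ab)).
by rewrite fst_of_pullback snd_of_pullback.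
Qed.

Lemma proj_fst_snd (w : pt_model P) :
  proj A (pt_fun (prod_fst P) w) = proj B (pt_fun (prod_snd P) w).
Proof. by rewrite !pt_fun_proj. Qed.

End ProductElements.
End PointElements.

(** * Transfer of congruences along fibres *)

Definition congruences_transfer (S : signature) (E : identities S) : Prop :=
  forall (A B X : model E) (f : homomorphism A X) (g : homomorphism B X)
    (C : pullback f g -> pullback f g -> Prop),
  congruence C ->
  forall (x y : A) (u v : B)
    (hxu : f x = g u) (hyu : f y = g u) (hxv : f x = g v) (hyv : f y = g v),
  C (pullback_elt hxu) (pullback_elt hyu) ->
  C (pullback_elt hxv) (pullback_elt hyv).

Section TransferCoequalizers.
Variables (S : signature) (E : identities S).
Hypothesis transfer : congruences_transfer E.
Variable X : variety E.

Lemma product_transfer (A B D : points X) (P : product A B) (h : hom (P : points X) D)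
    (w1 w2 w3 w4 : pt_model P) :
  pt_fun (prod_fst P) w1 = pt_fun (prod_fst P) w3 ->
  pt_fun (prod_fst P) w2 = pt_fun (prod_fst P) w4 ->
  pt_fun (prod_snd P) w1 = pt_fun (prod_snd P) w2 ->
  pt_fun (prod_snd P) w3 = pt_fun (prod_snd P) w4 ->
  pt_fun h w1 = pt_fun h w2 -> pt_fun h w3 = pt_fun h w4.
Proof.
move=> e13 e24 e12 e34 hw.
have p1 := proj_fst_snd w1.
have p2 := proj_fst_snd w2; rewrite -e12 in p2.
have p3 := proj_fst_snd w3; rewrite -e13 in p3.
have p4 := proj_fst_snd w4; rewrite -e24 -e34 in p4.
have := transfer (congruence_ker (hom_comp (pt_fun h) (of_pullback P)))
  (hxu := p1) (hyu := p2) p3 p4.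
have of_elt a b (ab : proj A a = proj B b) w :
    pt_fun (prod_fst P) w = a -> pt_fun (prod_snd P) w = b ->
    of_pullback P (pullback_elt ab) = w.
  by move=> wa wb; apply: product_elt_ext;
     rewrite ?fst_of_pullback ?snd_of_pullback.
rewrite /= (of_elt _ _ p1 w1) ?(of_elt _ _ p2 w2) //.
by rewrite (of_elt _ _ p3 w3) ?(of_elt _ _ p4 w4) //; apply.
Qed.

Lemma congruence_and (A : algebra S) (R R' : A -> A -> Prop) :
  congruence R -> congruence R' -> congruence (fun a b => R a b /\ R' a b).
Proof.
move=> Rc Rc'; split=> [a|a b [r r']|a b c [r r'] [t t']|o a b r].
- by split; [exact: (cong_refl Rc) | exact: (cong_refl Rc')].
- by split; [exact: (cong_sym Rc r) | exact: (cong_sym Rc' r')].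
- by split; [exact: (cong_trans Rc r t) | exact: (cong_trans Rc' r' t')].
- by split; [apply: (cong_op Rc) => i; case: (r i)
            |apply: (cong_op Rc') => i; case: (r i)].
Qed.

Lemma product_ker_fst (K A A' B D : points X) (u v : hom K A) (q : hom A A')
    (P : product A B) (h : hom (P : points X) D) :
  coequalizer u v q ->
  h ∘ prod_pair P (idm A) (zero_mor A B) ∘ u =
    h ∘ prod_pair P (idm A) (zero_mor A B) ∘ v ->
  forall w w', pt_fun (prod_snd P) w = pt_fun (prod_snd P) w' ->
    pt_fun q (pt_fun (prod_fst P) w) = pt_fun q (pt_fun (prod_fst P) w') ->
    pt_fun h w = pt_fun h w'.
Proof.
set s := prod_pair P _ _ => quv huv w w' ww' qww'.
have fst_s a : pt_fun (prod_fst P) (pt_fun s a) = a.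
  exact: (congr1 (fun k : hom A A => pt_fun k a)
            (prod_fst_pair P (idm A) (zero_mor A B))).
have snd_s a : pt_fun (prod_snd P) (pt_fun s a) = sec B (proj A a).
  exact: (congr1 (fun k : hom A B => pt_fun k a)
            (prod_snd_pair P (idm A) (zero_mor A B))).
have [] := @coequalizer_ker S E X K A A' u v q (fun a b =>
  proj A a = proj A b /\ pt_fun (h ∘ s) a = pt_fun (h ∘ s) b) quv _ _ _ _ _ qww'.
- by apply: congruence_and; apply: congruence_ker.
- by move=> a b [].
- by move=> c; split; [rewrite !pt_fun_proj | apply: pt_fun_eq].
move=> pww'; apply: product_transfer => //.
by rewrite !snd_s pww'.
Qed.

Lemma transfer_preserve_coequalizers : products_preserve_coequalizers (points X).
Proof.
move=> K1 Y Y' K2 Z Z' u v q1 u' v' q2 PK PY PY' c1 c2.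
apply: coequalizer_intro.
- move=> w; have [y qy] := coequalizer_surj c1 (pt_fun (prod_fst PY') w).
  have [z qz] := coequalizer_surj c2 (pt_fun (prod_snd PY') w).
  have [|t [ty tz]] := @product_eltP S E X Y Z PY y z.
    by rewrite -(pt_fun_proj q1) -(pt_fun_proj q2) qy qz proj_fst_snd.
  exists t; apply: product_elt_ext.
    by rewrite (pt_fun_eq t (fst_prod_mor _ _ _ _)) ty.
  by rewrite (pt_fun_eq t (snd_prod_mor _ _ _ _)) tz.
- have [[e1 _] [e2 _]] := (c1, c2).
  apply: product_hom_ext; rewrite !compmA.
    by rewrite !fst_prod_mor -!compmA !fst_prod_mor !compmA e1.
  by rewrite !snd_prod_mor -!compmA !snd_prod_mor !compmA e2.
move=> D h huv w w' qww'.
have q1ww' : pt_fun q1 (pt_fun (prod_fst PY) w) = pt_fun q1 (pt_fun (prod_fst PY) w').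
  by rewrite -!(pt_fun_eq _ (fst_prod_mor PY PY' q1 q2)) qww'.
have q2ww' : pt_fun q2 (pt_fun (prod_snd PY) w) = pt_fun q2 (pt_fun (prod_snd PY) w').
  by rewrite -!(pt_fun_eq _ (snd_prod_mor PY PY' q1 q2)) qww'.
have [|t [t1 t2]] := @product_eltP S E X Y Z PY
    (pt_fun (prod_fst PY) w') (pt_fun (prod_snd PY) w).
  by rewrite -(pt_fun_proj q1) -q1ww' pt_fun_proj proj_fst_snd.
transitivity (pt_fun h t).
  apply: (product_ker_fst c1) => //; rewrite ?t1 ?t2 //.
  by rewrite -!compmA (prod_mor_inl PK PY u u') (prod_mor_inl PK PY v v')
             !compmA huv.
apply: (product_ker_fst (P := product_swap PY) (h := h) c2).
- rewrite -!compmA (prod_mor_inl (product_swap PK) (product_swap PY) u' u).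
  rewrite (prod_mor_inl (product_swap PK) (product_swap PY) v' v) !compmA.
  by congr (_ ∘ _); apply: huv.
- by rewrite /= t1.
- by rewrite /= t2.
Qed.

End TransferCoequalizers.

(** * Principal congruences *)

Section Chain.
Variables (S : signature) (A : algebra S) (T : A -> A -> Prop).

(* Chains are padded by a constant tail, so that finitely many of them can be
   given the same length. *)
Definition chain (a b : A) : Prop := exists (w : nat -> A) (n : nat),
  [/\ w 0 = a, forall i, n <= i -> w i = b & forall i, T (w i) (w i.+1)].

Hypothesis T_refl : forall a, T a a.
Hypothesis T_sym : forall a b, T a b -> T b a.
Hypothesis T_op : forall (o : S) (a b : 'I_(arity o) -> A),
  (forall i, T (a i) (b i)) -> T (operation a) (operation b).

Lemma chain1 (a b : A) : T a b -> chain a b.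
Proof.
move=> ab; exists (fun i => if i is 0 then a else b), 1.
by split=> // -[|i].
Qed.

Lemma congruence_chain : congruence chain.
Proof.
split.
- by move=> a; apply/chain1/T_refl.
- move=> a b [w [n [w0 wn wT]]]; exists (fun i => w (n - i)), n.
  split=> [|i ni|i]; first by rewrite subn0 wn.
    by move: ni; rewrite -subn_eq0 => /eqP ->.
  case: (ltnP i n) => [ilt|ni]; last first.
    by move: ni (leqW ni); rewrite -!subn_eq0 => /eqP -> /eqP ->.
  by apply: T_sym; have := wT (n - i.+1); rewrite subnSK.
- move=> a b c [w [n [w0 wn wT]]] [w' [n' [w0' wn' wT']]].
  exists (fun i => if i <= n then w i else w' (i - n)), (n.+1 + n'); split=> //.
    by move=> i ni; rewrite leqNgt (leq_trans (leq_addr _ _) ni) /= wn' // leq_subRL;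
       [apply: leq_trans ni; rewrite addSn | apply: leq_trans ni; rewrite addSn leqW ?leq_addr].
  move=> i; case: (ltngtP i n) => [//|ni|->]; first by rewrite subSn // ltnW.
  by rewrite subSnn wn // -w0'; apply: wT'.
- move=> o a b /choice[w] /choice[n wn].
  exists (fun k => operation (fun i => w i k)), (\max_i n i); split.
  + by congr operation; apply: funext => i; case: (wn i).
  + move=> k nk; congr operation; apply: funext => i; case: (wn i) => _ + _.
    by apply; apply: leq_trans nk; apply: leq_bigmax.
  + by move=> k; apply: T_op => i; case: (wn i).
Qed.

End Chain.

Lemma eval_subst (S : signature) (A : algebra S) V W (env : W -> A)
    (r : V -> term S W) (t : term S V) :
  eval env (eval (A := term_algebra S W) r t) = eval (fun v => eval env (r v)) t.
Proof. exact: (hom_eval (eval_hom env) r t). Qed.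

Lemma term_support (S : signature) V (t : term S V) :
  exists s : seq {classic V}, forall (A : algebra S) (env env' : V -> A),
    {in s, forall v, env v = env' v} -> eval env t = eval env' t.
Proof.
elim: t => [v|o ts /choice[s sP]].
  by exists [:: v] => A env env' /= ->; rewrite ?mem_head.
exists (flatten (codom s)) => A env env' ee /=.
congr operation; apply: funext => i; apply: sP => v vs; apply: ee.
by apply/flattenP; exists (s i) => //; apply: codom_f.
Qed.

Section PrincipalCongruence.
Variables (S : signature) (A : algebra S).

Definition step_env (a b : A) (v : bool + A) : A :=
  match v with inl true => a | inl false => b | inr c => c end.

Definition step (a b c d : A) : Prop :=
  exists t : term S (bool + A), c = eval (step_env a b) t /\ d = eval (step_env b a) t.

Lemma congruence_step_chain (a b : A) : congruence (chain (step a b)).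
Proof.
apply: congruence_chain.
- by move=> c; exists (Var S (inr c)).
- move=> c d [t [-> ->]].
  exists (eval (A := term_algebra S _)
    (fun v => Var S (match v with inl e => inl (~~ e) | inr e => inr e end)) t).
  by rewrite !eval_subst; split; apply: eq_eval => -[[]|].
- move=> o c d /choice[t tP]; exists (App t) => /=.
  by split; congr operation; apply: funext => i; case: (tP i).
Qed.

Lemma step_chain_gen (a b : A) : chain (step a b) a b.
Proof.
apply: chain1; last by exists (Var S (inl true)).
by move=> c; exists (Var S (inr c)).
Qed.

Lemma step_chain_terms (a b c d : A) : chain (step a b) c d ->
  exists (m n : nat) (e : 'I_m.+1 -> A) (p : nat -> term S 'I_m.+3),
    [/\ eval_xyz (p 1) a b e = c, eval_xyz (p n.+1) b a e = d
      & forall i, 1 <= i < n.+1 -> eval_xyz (p i) b a e = eval_xyz (p i.+1) a b e].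
Proof.
move=> [w [n [w0 wn /choice[t tP]]]].
have /choice[s sP] := fun i => term_support (t i).
pose inrs (v : {classic (bool + A)}) : seq {classic A} :=
  if v is inr f then [:: f] else [::].
pose l : seq {classic A} :=
  flatten [seq flatten [seq inrs v | v <- s i] | i <- iota 0 n.+1].
pose e (j : 'I_(size l).+1) : A := nth (a : {classic A}) l j.
pose r (v : bool + A) : 'I_(size l).+3 := match v with
  | inl true => ord0
  | inl false => lift ord0 ord0
  | inr f => lift ord0 (lift ord0 (inord (index (f : {classic A}) l))) end.
pose p i : term S 'I_(size l).+3 :=
  eval (A := term_algebra S _) (fun v => Var S (r v)) (t i.-1).
have pE i x y : i <= n -> eval_xyz (p i.+1) x y e = eval (step_env x y) (t i).
  move=> ile; rewrite /eval_xyz eval_subst; apply: sP => -[[]|f] vs //=.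
  rewrite !tnthS tnth_mktuple /e inordK ?nth_index ?ltnS ?index_size //.
  apply/flattenP; exists (flatten [seq inrs v | v <- s i]).
    by apply/mapP; exists i; rewrite ?mem_iota.
  apply/flattenP; exists (inrs (inr f : {classic (bool + A)})); last exact: mem_head.
  by apply/mapP; exists (inr f : {classic (bool + A)}).
exists (size l), n, e, p; split=> [||[//|i] ile].
- by rewrite pE // -(tP 0).1.
- by rewrite pE // -(tP n).2 wn.
by rewrite !pE ?[i <= n]ltnW // -(tP i).2 -(tP i.+1).1.
Qed.

End PrincipalCongruence.

(** * Terms from normal projections *)

Definition transfer_terms (S : signature) (E : identities S) : Prop :=
  exists m n : nat, [/\ 0 < m, 0 < n &
      exists (b c : 'I_m -> term S 'I_2) (p : nat -> term S 'I_m.+2),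
      forall A : model E,
        let bs (x y : A) := fun j : 'I_m => eval2 (b j) x y in
        let cs (u v : A) := fun j : 'I_m => eval2 (c j) u v in
        [/\ forall x y : A, eval_xyz (p 1) x y (bs x y) = x,
            forall x y : A, eval_xyz (p n) y x (bs x y) = y,
            forall i, 1 <= i < n -> forall x y : A,
              eval_xyz (p i) y x (bs x y) = eval_xyz (p i.+1) x y (bs x y),
            forall i, 1 <= i <= n -> forall u v : A,
              eval_xyz (p i) u u (cs u v) = v
          & forall (j : 'I_m) (z : A), eval2 (b j) z z = eval2 (c j) z z]].

Lemma hom_eval_xyz (S : signature) (A B : algebra S) (f : homomorphism A B) m
    (t : term S 'I_m.+2) x y (z : 'I_m -> A) (z' : 'I_m -> B) :
  (forall j, f (z j) = z' j) -> f (eval_xyz t x y z) = eval_xyz t (f x) (f y) z'.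
Proof.
move=> zz'; rewrite /eval_xyz hom_eval; apply: eq_eval => i.
case: (unliftP ord0 i) => [j|] ->; last by [].
case: (unliftP ord0 j) => [k|] ->; last by [].
by rewrite !tnthS !tnth_mktuple.
Qed.

Lemma hom_eval2 (S : signature) (A B : algebra S) (f : homomorphism A B)
    (t : term S 'I_2) x y :
  f (eval2 t x y) = eval2 t (f x) (f y).
Proof.
by rewrite /eval2 hom_eval; apply: eq_eval => -[[|[|//]] ?]; rewrite !(tnth_nth x, tnth_nth (f x)).
Qed.

Local Notation vx := (ord0 : 'I_2).
Local Notation vy := (ord_max : 'I_2).

Lemma fst_eval_pullback (S : signature) (A B X : algebra S)
    (f : homomorphism A X) (g : homomorphism B X) V
    (env : V -> pullback f g) (t : term S V) :
  (sval (eval env t)).1 = eval (fun v => (sval (env v)).1) t.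
Proof. exact: (hom_eval (pullback_fst f g)). Qed.

Lemma snd_eval_pullback (S : signature) (A B X : algebra S)
    (f : homomorphism A X) (g : homomorphism B X) V
    (env : V -> pullback f g) (t : term S V) :
  (sval (eval env t)).2 = eval (fun v => (sval (env v)).2) t.
Proof. exact: (hom_eval (pullback_snd f g)). Qed.

Section FreePoint.
Variables (S : signature) (E : identities S).

Definition free_map V W (f : V -> W) : homomorphism (free E V) (free E W) :=
  projT1 (cid (free_lift (fun v => gen E (f v)))).

Lemma free_map_gen V W (f : V -> W) v : free_map f (gen E v) = gen E (f v).
Proof. by rewrite /free_map; case: cid => k []. Qed.

Definition fold : homomorphism (free E 'I_2) (free E unit) := free_map (fun=> tt).

Lemma fold_split :
  compm (c := variety E) (fold : hom (free E 'I_2 : variety E) (free E unit))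
    (free_map (fun=> ord0)) = idm (free E unit : variety E).
Proof. by apply: free_hom_ext => -[] /=; rewrite !free_map_gen. Qed.

Definition free_point : points (free E unit : variety E) := Point fold_split.

Lemma fold_sec_fold (t : term S 'I_2) :
  sec free_point (fold (free_class E t)) = eval (fun=> gen E ord0) t.
Proof.
rewrite free_classE !hom_eval; apply: eq_eval => i.
by rewrite /sec /= !free_map_gen.
Qed.

Lemma fold_gen (i j : 'I_2) : fold (gen E i) = fold (gen E j).
Proof. by rewrite !free_map_gen. Qed.

Definition gen_pair (i j : 'I_2) : pullback fold fold :=
  pullback_elt (fold_gen i j).

Lemma normal_projections_transfer_free
    (C : pullback fold fold -> pullback fold fold -> Prop) :
  normal_local_projections (variety E) -> congruence C ->
  C (gen_pair vx vx) (gen_pair vy vx) -> C (gen_pair vx vy) (gen_pair vy vy).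
Proof.
move=> N Cc C01.
pose P := points_product free_point free_point.
have [_ [K [k [k0 U]]]] := N _ _ _ P.
have [||Z [q [_ qP]]] := @pt_quotient S E _ P
    (fun r r' => C r r' /\ proj P r = proj P r').
- by apply: congruence_and => //; apply: congruence_ker.
- by move=> r r' [].
have [|h [hq _]] := U Z q.
  apply: pt_fun_inj => kappa.
  rewrite -[RHS]/(pt_fun (zero_mor K Z) kappa).
  have -> : pt_fun (zero_mor K Z) kappa = pt_fun q (sec P (proj K kappa)).
    by rewrite pt_fun_sec.
  apply/qP; split; last by rewrite pt_fun_proj sec_proj.
  have := congr1 (fun f => pt_fun f kappa) k0.
  have := pt_fun_proj k kappa.
  rewrite -[pt_fun (zero_mor K _) kappa]/(sec free_point (proj K kappa)).
  rewrite -[pt_fun (_ ∘ k) kappa]/(sval (pt_fun k kappa)).2.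
  set x := proj K kappa; set w := pt_fun k kappa => wx w2.
  have [t tE] := free_class_surj (sval w).1.
  have xE : x = fold (free_class E t) by rewrite -wx -tE.
  have -> : w = eval (A := pullback fold fold) (fun i => gen_pair i vx) t.
    apply: pullback_eq; rewrite [LHS]surjective_pairing [RHS]surjective_pairing.
    rewrite w2 tE xE [in LHS]fold_sec_fold free_classE.
    by rewrite fst_eval_pullback snd_eval_pullback.
  have -> : sec P x = eval (A := pullback fold fold) (fun=> gen_pair vx vx) t.
    apply: pullback_eq; rewrite [RHS]surjective_pairing.
    rewrite -[LHS]/(sec free_point x, sec free_point x) xE [in LHS]fold_sec_fold.
    by rewrite fst_eval_pullback snd_eval_pullback.
  apply: (cong_eval _ Cc) => i; case: (unliftP vx i) => [j|] ->; last exact: (cong_refl Cc).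
  rewrite (_ : lift _ _ = vy); first exact: (cong_sym Cc).
  by apply: val_inj; rewrite (ord1 j).
have : pt_fun q (gen_pair vx vy) = pt_fun q (gen_pair vy vy).
  by rewrite -hq.
by move/qP => [].
Qed.

Lemma normal_projections_terms :
  normal_local_projections (variety E) -> transfer_terms E.
Proof.
move=> N.
have := normal_projections_transfer_free N (congruence_step_chain _ _)
  (step_chain_gen (gen_pair vx vx) (gen_pair vy vx)).
move=> /step_chain_terms[m [n [e [p [p1 pn pS]]]]].
have /choice[b bE] := fun j => free_class_surj (sval (e j)).1.
have /choice[c cE] := fun j => free_class_surj (sval (e j)).2.
exists m.+1, n.+1; split=> //; exists b, c, p => A /=.
have /choice[lift2 lift2P] : forall xy : A * A,
    exists k : homomorphism (free E 'I_2) A,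
      [/\ k (gen E vx) = xy.1, k (gen E vy) = xy.2
        & forall t, k (free_class E t) = eval2 t xy.1 xy.2].
  by move=> [x y]; have [k [kg kt]] := free_lift (tnth [tuple x; y]);
     exists k; rewrite !kg.
have fstE t x y i j : hom_comp (lift2 (x, y)) (pullback_fst fold fold)
      (eval_xyz t (gen_pair i vx) (gen_pair j vx) e)
    = eval_xyz t (lift2 (x, y) (gen E i)) (lift2 (x, y) (gen E j))
        (fun j => eval2 (b j) x y).
  apply: hom_eval_xyz => j'; rewrite /= bE.
  by case: (lift2P (x, y)) => _ _ ->.
have sndE t u v i j : hom_comp (lift2 (u, v)) (pullback_snd fold fold)
      (eval_xyz t (gen_pair i vx) (gen_pair j vx) e)
    = eval_xyz t u u (fun j => eval2 (c j) u v).
  have [l0 _ l2] := lift2P (u, v).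
  rewrite (@hom_eval_xyz _ _ _ _ _ t _ _ e (fun j' => eval2 (c j') u v)) /= ?l0 // => j'.
  by rewrite cE l2.
split.
- move=> x y; have [/= l0 l1 _] := lift2P (x, y).
  by have := fstE (p 1) x y vx vy; rewrite l0 l1 p1 /= l0.
- move=> x y; have [/= l0 l1 _] := lift2P (x, y).
  by have := fstE (p n.+1) x y vy vx; rewrite l0 l1 pn /= l1.
- move=> i /pS pi x y; have [/= l0 l1 _] := lift2P (x, y).
  have := fstE (p i) x y vy vx; have := fstE (p i.+1) x y vx vy.
  by rewrite l0 l1 pi => -> ->.
- move=> i /andP[i0 iln] u v; have [/= l0 l1 _] := lift2P (u, v).
  elim: i i0 iln => // -[_ _ _|i IH _ iln].
    by rewrite -(sndE _ _ _ vx vy) p1.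
  by rewrite -(sndE _ _ _ vx vy) -pS // (sndE _ _ _ vy vx) IH // ltnW.
move=> j z; have [k [kg _]] := @free_lift S E unit A (fun=> z).
have kE t : k (fold (free_class E t)) = eval2 t z z.
  rewrite free_classE !hom_eval; apply: eq_eval => i.
  by rewrite free_map_gen kg (tnth_nth z); case: i => -[|[]].
by rewrite -!kE -bE -cE (svalP (e j)).
Qed.

End FreePoint.

(* Apply p_i to (x, u), (y, u) and the elements (b_j(x, y), c_j(u, v)) of the pullback:
   the second component is v throughout, and the first runs from x to y. *)
Lemma terms_transfer (S : signature) (E : identities S) :
  transfer_terms E -> congruences_transfer E.
Proof.
move=> [m [n [_ n0 [b [c [p pP]]]]]] A B X f g C Cc x y u v hxu hyu hxv hyv Cxy.
have [pA1 pAn pAS _ _] := pP A; have [_ _ _ pB _] := pP B.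
have [_ _ _ _ bc] := pP X.
have ej j : f (eval2 (b j) x y) = g (eval2 (c j) u v).
  by rewrite !hom_eval2 hyu -hxu -hxv hxu bc.
pose e j := pullback_elt (ej j).
pose w i := eval_xyz (p i) (pullback_elt hxu) (pullback_elt hyu) e.
pose w' i := eval_xyz (p i) (pullback_elt hyu) (pullback_elt hxu) e.
have w1 i : (sval (w i)).1 = eval_xyz (p i) x y (fun j => eval2 (b j) x y).
  exact: (@hom_eval_xyz _ _ _ (pullback_fst f g)).
have w'1 i : (sval (w' i)).1 = eval_xyz (p i) y x (fun j => eval2 (b j) x y).
  exact: (@hom_eval_xyz _ _ _ (pullback_fst f g)).
have w2 i : 1 <= i <= n -> (sval (w i)).2 = v.
  move=> iln; rewrite -[RHS](pB i iln u v).
  exact: (@hom_eval_xyz _ _ _ (pullback_snd f g)).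
have w'2 i : 1 <= i <= n -> (sval (w' i)).2 = v.
  move=> iln; rewrite -[RHS](pB i iln u v).
  exact: (@hom_eval_xyz _ _ _ (pullback_snd f g)).
have Cw i : C (w i) (w' i).
  apply: (cong_eval _ Cc) => k.
  case: (unliftP ord0 k) => [k'|] ->; last exact: Cxy.
  case: (unliftP ord0 k') => [j|] ->; last exact: (cong_sym Cc Cxy).
  by rewrite !tnthS; apply: (cong_refl Cc).
have pbE (r r' : pullback f g) :
    (sval r).1 = (sval r').1 -> (sval r).2 = (sval r').2 -> r = r'.
  move=> e1 e2; apply: pullback_eq.
  by rewrite [LHS]surjective_pairing [RHS]surjective_pairing e1 e2.
have chain i : i < n -> C (w 1) (w' i.+1).
  elim: i => [|i IH] iln; first exact: Cw.
  apply: (cong_trans Cc (IH (ltnW iln))).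
  have -> : w' i.+1 = w i.+2.
    by apply: pbE; rewrite ?w'1 ?w1 ?pAS ?w'2 ?w2 //= ltnW.
  exact: Cw.
have -> : pullback_elt hxv = w 1 by apply: pbE; rewrite ?w1 ?w2 ?pA1.
have -> : pullback_elt hyv = w' n.-1.+1.
  by apply: pbE; rewrite prednK // ?w'1 ?w'2 ?pAn ?n0 /=.
by apply: chain; rewrite prednK.
Qed.

Theorem theorem3 (S : signature) (E : identities S) :
  [<->
    (* 1 *)
    forall X : variety E, products_preserve_coequalizers (points X);
    (* 2 *)
    forall X : variety E, products_preserve_normal_epis (points X);
    (* 3 *)
    normal_local_projections (variety E);
    (* 4; only the terms p i with 1 <= i <= n are relevant *)
    exists m n : nat, [/\ 0 < m, 0 < n &
      exists (b c : 'I_m -> term S 'I_2) (p : nat -> term S 'I_m.+2),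
      forall A : model E,
        let bs (x y : A) := fun j : 'I_m => eval2 (b j) x y in
        let cs (u v : A) := fun j : 'I_m => eval2 (c j) u v in
        [/\ forall x y : A, eval_xyz (p 1) x y (bs x y) = x,
            forall x y : A, eval_xyz (p n) y x (bs x y) = y,
            forall i, 1 <= i < n -> forall x y : A,
              eval_xyz (p i) y x (bs x y) = eval_xyz (p i.+1) x y (bs x y),
            forall i, 1 <= i <= n -> forall u v : A,
              eval_xyz (p i) u u (cs u v) = v
          & forall (j : 'I_m) (z : A), eval2 (b j) z z = eval2 (c j) z z]];
    (* 5 *)
    forall (A B X : model E) (f : homomorphism A X) (g : homomorphism B X)
      (C : pullback f g -> pullback f g -> Prop),
      congruence C ->
      forall (x y : A) (u v : B)
        (hxu : f x = g u) (hyu : f y = g u) (hxv : f x = g v) (hyv : f y = g v),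
        C (pullback_elt hxu) (pullback_elt hyu) ->
        C (pullback_elt hxv) (pullback_elt hyv)].
Proof.
tfae.
- move=> H X; apply: preserve_coequalizers_normal_epis => // A B.
  by exists (points_product A B).
- by move=> H X; apply: preserve_normal_epis_projections.
- exact: normal_projections_terms.
- exact: terms_transfer.
- by move=> H X; apply: transfer_preserve_coequalizers.
Qed.
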